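(* For all pairs of natural numbers $(n,d)$ satisfying one of the following criteria: (i) $n \ge 5$ is odd and $d = 2$; or (ii) $n \ge 7$ and $3 \le d \le n-3$, there exists an $(n,d)$-PTF $f_{n,d}$ with $\mathbf{AS}[f_{n,d}] > \mathbf{AS}[f^*_{n,d}]$. Moreover, $\mathbf{AS}[f_{n,d}] \in \left(1 + \Omega\left(n^{-1} e^{-d^2/n}\right)\right)\mathbf{AS}[f^*_{n,d}]$, i.e. there is an absolute constant $c>0$ such that $\mathbf{AS}[f_{n,d}] \ge \left(1 + c\, n^{-1} e^{-d^2/n}\right)\mathbf{AS}[f^*_{n,d}]$ for all such $(n,d)$.
   Context: A boolean function $f:\{-1,1\}^n\to\{-1,1\}$ is an $(n,d)$-PTF (polynomial threshold function of degree $d$ on $n$ variables) if there is a polynomial $p\in\mathbb{R}[x_1,\dots,x_n]$ of degree at most $d$ with $f(x)=\mathrm{sgn}(p(x))$ for all $x\in\{-1,1\}^n$. The dichromatic count $\mathbf{D}[f]$ is the number of unordered pairs $\{x,y\}$ of points of $\{-1,1\}^n$ differing in exactly one coordinate with $f(x)\ne f(y)$; the average sensitivity is $\mathbf{AS}[f]=2^{1-n}\mathbf{D}[f]$. Let $p^*_{n,d}$ be the monic univariate polynomial of degree $d$ with (non-repeated) roots at the $d$ integers closest to $0$ of opposite parity from $n$, and let $f^*_{n,d}(x_1,\dots,x_n)=\mathrm{sgn}\left(p^*_{n,d}\left(\sum_{i=1}^n x_i\right)\right)$. *)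

(* Defs.v *)
From HB Require Import structures.
From mathcomp Require Import all_boot all_order all_algebra.
From mathcomp Require Import mpoly zify.

Set Implicit Arguments.
Unset Strict Implicit.
Unset Printing Implicit Defensive.

Import Order.TTheory GRing.Theory Num.Theory.
Local Open Scope ring_scope.

(* The cube {-1,1}^n is encoded as {ffun 'I_n -> bool}: the bit b stands for
   the coordinate (-1)^b. *)
Definition cube (n : nat) : finType := {ffun 'I_n -> bool}.

Definition coord (n : nat) (x : cube n) (i : 'I_n) : int := (-1) ^+ x i.

Definition boolean (n : nat) (f : cube n -> int) : Prop :=
  forall x, f x = 1 \/ f x = -1.

(* [sgz 0 = 0], so a polynomial representing f has no zero on the cube.
   [msize p] is one more than the total degree of p, and is 0 for p = 0. *)
Definition PTF (R : realDomainType) (n d : nat) (f : cube n -> int) : Prop :=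
  boolean f /\
  exists p : {mpoly R[n]},
    (msize p <= d.+1)%N /\
    forall x : cube n, f x = sgz p.@[fun i => (coord x i)%:~R].

Definition adjacent (n : nat) (x y : cube n) : bool :=
  #|[set i | coord x i != coord y i]| == 1%N.

Definition dichromatic (n : nat) (f : cube n -> int) : nat :=
  #|[set e : {set cube n} |
      [exists x, exists y, [&& e == [set x; y], adjacent x y & f x != f y]]]|.

Definition AS (R : realFieldType) (n : nat) (f : cube n -> int) : R :=
  2 ^ (1 - n%:Z) * (dichromatic f)%:R.

Definition opp_parity (n : nat) (z : int) : bool := odd `|z|%N != odd n.

(* When d > 0 and n + d is odd, the candidates z and -z for the last root
   are tied, and exactly two sets of roots (exchanged by negation) qualify. *)
Definition closest_roots (n d : nat) (s : seq int) : Prop :=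
  [/\ uniq s, size s = d, all (opp_parity n) s &
      forall z w, z \in s -> w \notin s -> opp_parity n w -> `|z| <= `|w|].

Definition pstar (s : seq int) : {poly int} := \prod_(a <- s) ('X - a%:P).

Definition fstar (n : nat) (s : seq int) (x : cube n) : int :=
  sgz (pstar s).[\sum_(i < n) coord x i].

Lemma closest_roots_exist (n d : nat) : exists s, closest_roots n d s.
Proof.
pose r (k : nat) : int :=
  (if odd k then -1 else 1) *
  (if odd n then (uphalf k).*2%:Z else (k./2).*2.+1%:Z).
have absr k : `|r k|%N = if odd n then (uphalf k).*2 else (k./2).*2.+1.
  by rewrite /r; case: (odd k); case: (odd n); lia.
have rinj : injective r.
  move=> j k; rewrite /r.
  have := odd_double_half j; have := odd_double_half k.
  rewrite !uphalf_half; case: (odd j); case: (odd k); case: (odd n) => /=; lia.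
have rsurj w : opp_parity n w -> exists k, w = r k.
  rewrite /opp_parity; case: w => m /=; rewrite ?NegzE ?abszN ?absz_nat.
    have := odd_double_half m; case on: (odd n); case om: (odd m) => //= dm _.
      by exists m; rewrite /r on om; lia.
    by exists m.-1; rewrite /r on; case: m om dm => //= m; case: (odd m) => //=; lia.
  case on: (odd n); case om: (odd m) => //= _; have := odd_double_half m.
    by exists m; rewrite /r on om /=; lia.
  by exists m.+1; rewrite /r on /= om /=; lia.
exists [seq r k | k <- iota 0 d]; split.
- by rewrite map_inj_uniq ?iota_uniq.
- by rewrite size_map size_iota.
- apply/allP => z /mapP[k _ ->]; rewrite /opp_parity absr.
  by case: (odd n); rewrite /= odd_double.
- move=> z w /mapP[k]; rewrite mem_iota /= add0n => kd -> wN /rsurj[j wj].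
  move: wN; rewrite {}wj => wN.
  have dj : (d <= j)%N.
    rewrite leqNgt; apply: contra wN => jd.
    by apply: map_f; rewrite mem_iota.
  rewrite -!abszE lez_nat !absr.
  have kj : (k <= j)%N by lia.
  by case: (odd n); lia.
Qed.

(* Main.v *)
Require Import Defs.
From mathcomp Require Import all_boot all_order all_algebra.
From mathcomp Require Import zify ring lra.
From mathcomp Require mpoly.

(** Write [n = k + N] with [N = 2 l + d + 1], where [k = 2] if [n + d] is odd and
[k = 3] otherwise, and let [t] and [j] count the [-1]s among the first [k] and
the last [N] coordinates.  In terms of [j], every slice [t = const] of [f*]
changes sign at [d] consecutive gaps, shifted by one as [t] increases.  At the
corner [t = k] (and also at [t = 0] when [k = 3]) the slice of [f*] has drifted
off the [d + 1] middle gaps of the [N]-cube; replace it by the slice that changes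
sign at all of these gaps but the second (resp. the last but one).  This keeps
all but one layer different from the neighbouring slice, and counting edges shows
that each replacement gains exactly [(d + 1 - k) 'C(N, l)] dichromatic edges.

The new function is still a PTF of degree [d]: it is the sign of
[K * B + q] with [K] large, where [B] vanishes exactly on the [d] middle layers of
the [N]-cube.  There only the sign of [q] matters, and [q] is the interpolation in
[t] of slice polynomials of degree [d - 1] in [j], chosen so that the coefficient
of [j ^ (d - 1 - i)] has degree at most [i + 1] in [t].

Since [f*] has at most [4 n d 'C(N, N/2)] dichromatic edges, the quantitative
bound reduces to [ 'C(N, N/2) <= e^5 'C(N, l) exp(d^2/n) ]. *)

Set Implicit Arguments.
Unset Strict Implicit.
Unset Printing Implicit Defensive.

Import Order.TTheory GRing.Theory Num.Theory Defs.
Local Open Scope ring_scope.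

(** * Polynomial functions on the cube *)

Section PolynomialFunctions.
Import mpoly.
Variables (R : realDomainType) (n : nat).
Implicit Types (g h : cube n -> R) (d e : nat).

(** Degree is attached to functions on the cube, so that later bounds compose without writing a
    multivariate polynomial. *)
Definition polyfun d g : Prop :=
  exists p : {mpoly R[n]},
    (msize p <= d.+1)%N /\
    forall x, p.@[fun i => (coord x i)%:~R] = g x.

Lemma polyfun_leq d e g : (d <= e)%N -> polyfun d g -> polyfun e g.
Proof. by move=> le_de [p [sp pE]]; exists p; split=> //; lia. Qed.

Lemma eq_polyfun d g h : g =1 h -> polyfun d g -> polyfun d h.
Proof. by move=> gh [p [sp pE]]; exists p; split=> // x; rewrite pE gh. Qed.

Lemma polyfun_cst d (a : R) : polyfun d (fun=> a).
Proof.
exists (a%:MP); split; last by move=> x; rewrite mevalC.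
by rewrite msizeC; case: (a != 0).
Qed.

Lemma polyfun_coord i : polyfun 1 (fun x => (coord x i)%:~R).
Proof.
exists ('X_i); split; last by move=> x; rewrite mevalXU.
by rewrite msizeX mdeg1.
Qed.

Lemma polyfunD d g h :
  polyfun d g -> polyfun d h -> polyfun d (fun x => g x + h x).
Proof.
move=> [p [sp pE]] [q [sq qE]]; exists (p + q); split; last first.
  by move=> x; rewrite mevalD pE qE.
by apply: leq_trans (msizeD_le _ _) _; rewrite geq_max sp sq.
Qed.

Lemma polyfunM d e g h :
  polyfun d g -> polyfun e h -> polyfun (d + e) (fun x => g x * h x).
Proof.
move=> [p [sp pE]] [q [sq qE]]; exists (p * q); split; last first.
  by move=> x; rewrite mevalM pE qE.
have [->|p0] := eqVneq p 0; first by rewrite mul0r msize0.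
have [->|q0] := eqVneq q 0; first by rewrite mulr0 msize0.
by rewrite msizeM //; move: (msize p) (msize q) sp sq; clear=> a b; lia.
Qed.

Lemma polyfunZ d (a : R) g : polyfun d g -> polyfun d (fun x => a * g x).
Proof. by rewrite -[d]add0n; apply: polyfunM; apply: polyfun_cst. Qed.

Lemma polyfun_sum (I : Type) (r : seq I) d (G : I -> cube n -> R) :
  (forall i, polyfun d (G i)) -> polyfun d (fun x => \sum_(i <- r) G i x).
Proof.
move=> dG; elim: r => [|i r IHr].
  by apply: eq_polyfun (polyfun_cst d 0) => x; rewrite big_nil.
by apply: eq_polyfun (polyfunD (dG i) IHr) => x; rewrite big_cons.
Qed.

Lemma polyfun_horner d (P : {poly R}) g :
  (size P <= d.+1)%N -> polyfun 1 g -> polyfun d (fun x => P.[g x]).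
Proof.
move=> sP dg; have dgX m : polyfun m (fun x => g x ^+ m).
  elim: m => [|m IHm]; first exact: polyfun_cst.
  by rewrite -add1n; apply: eq_polyfun (polyfunM dg IHm) => x; rewrite exprS.
apply: (@eq_polyfun _ (fun x => \sum_(i < size P) P`_i * g x ^+ i)).
  by move=> x; rewrite horner_coef.
apply: polyfun_sum => i; apply/polyfunZ/(polyfun_leq _ (dgX i)).
by have := ltn_ord i; lia.
Qed.

Lemma polyfun_PTF d (f : cube n -> int) g :
  boolean f -> polyfun d g -> (forall x, f x = sgz (g x)) -> PTF R d f.
Proof.
by move=> bf [p [sp pE]] fE; split=> //; exists p; split=> // x; rewrite pE.
Qed.

End PolynomialFunctions.

(** * Counting dichromatic edges *)

Section EdgeCount.
Variable n : nat.
Implicit Types (x y : cube n) (i : 'I_n).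

Definition flip x i : cube n := [ffun m => if m == i then ~~ x m else x m].

Lemma flipE x i m : flip x i m = if m == i then ~~ x m else x m.
Proof. by rewrite ffunE. Qed.

Lemma flip_neq x i : flip x i != x.
Proof.
by apply/eqP=> /ffunP/(_ i); rewrite flipE eqxx; case: (x i).
Qed.

Lemma flip_inj x : injective (flip x).
Proof.
move=> i j /ffunP/(_ i); rewrite !flipE eqxx.
by case: eqVneq => // _; case: (x i).
Qed.

Lemma adjacentP x y :
  reflect (exists i, y = flip x i) (adjacent x y).
Proof.
have nE i : (coord x i != coord y i) = (x i != y i).
  by rewrite /coord; case: (x i); case: (y i).
rewrite /adjacent; under eq_finset do rewrite nE.
apply: (iffP cards1P) => [[i /setP xy]|[i ->]]; exists i.
  apply/ffunP=> m; rewrite flipE; have := xy m; rewrite !inE.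
  by case: (m == i); case: (x m); case: (y m).
apply/setP=> m; rewrite !inE flipE; case: (m == i); last by rewrite eqxx.
by case: (x m).
Qed.

(** An edge has exactly one endpoint whose bit in the flipped direction is false; counting it from
    there replaces unordered pairs by points and directions. *)
Lemma dichromaticE (f : cube n -> int) :
  dichromatic f = (\sum_(x : cube n) \sum_(i | ~~ x i) (f x != f (flip x i)))%N.
Proof.
pose A := [set u : cube n * 'I_n | ~~ u.1 u.2 & f u.1 != f (flip u.1 u.2)].
transitivity #|A|; last first.
  rewrite pair_big_dep /= -sum1_card [LHS]big_mkcond [RHS]big_mkcond /=.
  by apply: eq_bigr => -[x i] _ /=; rewrite inE /=; case: (x i) => //=; case: eqP.
pose h (u : cube n * 'I_n) := [set u.1; flip u.1 u.2].
suff [hA h_inj] : [set e : {set cube n} | [exists x, exists y,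
    [&& e == [set x; y], adjacent x y & f x != f y]]] = h @: A /\ {in A &, injective h}.
  by rewrite /dichromatic hA card_in_imset.
split.
  apply/setP=> e; rewrite inE; apply/existsP/imsetP.
    move=> [x /existsP[y /and3P[/eqP-> /adjacentP[i ->] fxy]]].
    have [xi|xi] := boolP (x i); last by exists (x, i); rewrite ?inE /= ?xi.
    have fl : flip (flip x i) i = x.
      by apply/ffunP=> m; rewrite !flipE; case: eqP => // _; rewrite negbK.
    exists (flip x i, i); last by rewrite /h /= fl setUC.
    by rewrite inE /= flipE eqxx xi fl eq_sym.
  move=> [[x i]]; rewrite inE /= => /andP[_ fx] ->; exists x; apply/existsP.
  exists (flip x i); rewrite eqxx fx andbT /=; apply/adjacentP; by exists i.
move=> [x i] [y j]; rewrite !inE /h /= => /andP[xi _] /andP[yj _] e.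
have xy : x = y.
  have : x \in [set y; flip y j] by rewrite -e !inE eqxx.
  have : y \in [set x; flip x i] by rewrite e !inE eqxx.
  rewrite !inE => /orP[/eqP-> //|/eqP yE] /orP[/eqP-> //|/eqP xE].
  have := congr1 (fun z : cube n => z i) yE; have := congr1 (fun z : cube n => z i) xE.
  rewrite /= !flipE eqxx (negbTE xi) /=; case: eqVneq => [->|_ <- //].
  by rewrite (negbTE yj).
rewrite -{y}xy in yj e *; congr (_, _); apply: (@flip_inj x).
have : flip x i \in [set x; flip x j] by rewrite -e !inE eqxx orbT.
by rewrite !inE (negbTE (flip_neq _ _)) => /eqP.
Qed.

Definition weight x : nat := (\sum_i x i)%N.

Lemma weight_flip x i : ~~ x i -> weight (flip x i) = (weight x).+1.
Proof.
move=> xi; rewrite /weight (bigD1 i) //= [in RHS](bigD1 i) //=.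
rewrite flipE eqxx (negbTE xi) /= add0n add1n; congr _.+1.
by apply: eq_bigr => m /negbTE mi; rewrite flipE mi.
Qed.

Lemma card_zeros x : (\sum_(i | ~~ x i) 1 = n - weight x)%N.
Proof.
have : (\sum_(i | ~~ x i) 1 + weight x = n)%N.
  rewrite -[RHS]card_ord -sum1_card /weight big_mkcond -big_split /=.
  by apply: eq_bigr => i _; case: (x i).
lia.
Qed.

Lemma weight_leq x : (weight x <= n)%N.
Proof.
rewrite -[leqRHS]card_ord -sum1_card; apply: leq_sum => i _; exact: leq_b1.
Qed.

Lemma card_weight j : #|[set x : cube n | weight x == j]| = 'C(n, j).
Proof.
rewrite -[in RHS](card_ord n) -card_draws.
pose h (x : cube n) : {set 'I_n} := [set i | x i].
have h_inj : injective h.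
  by move=> x y /setP xy; apply/ffunP=> i; have := xy i; rewrite !inE.
rewrite -(card_imset _ h_inj); apply: eq_card => A; rewrite inE.
have hw x : #|h x| = weight x.
  rewrite -sum1_card big_mkcond /=; apply: eq_bigr => i _; rewrite inE.
  by case: (x i).
apply/imsetP/eqP=> [[x]|cA]; first by rewrite inE => /eqP <- ->.
exists [ffun i => i \in A]; last by apply/setP=> i; rewrite inE ffunE.
by rewrite inE -hw -cA; apply/eqP/eq_card => i; rewrite inE ffunE.
Qed.

Lemma sum_weight (g : nat -> nat) :
  (\sum_(x : cube n) g (weight x) = \sum_(j < n.+1) 'C(n, j) * g j)%N.
Proof.
rewrite (partition_big (fun x => inord (weight x) : 'I_n.+1) xpredT) //=.
apply: eq_bigr => j _; rewrite -card_weight -sum1_card big_distrl /=.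
have wj x : (inord (weight x) == j) = (weight x == j).
  by rewrite -val_eqE /= inordK // ltnS weight_leq.
by apply: eq_big => [x|x]; rewrite ?inE wj // => /eqP->; rewrite mul1n.
Qed.

End EdgeCount.

Section BlockCount.
Variables k N : nat.
Implicit Types x : cube (k + N).

Definition lpart x : cube k := [ffun i => x (lshift N i)].
Definition rpart x : cube N := [ffun i => x (rshift k i)].

Lemma sum_parts (g : nat -> nat -> nat) :
  (\sum_(x : cube (k + N)) g (weight (lpart x)) (weight (rpart x)) =
   \sum_(t < k.+1) \sum_(j < N.+1) 'C(k, t) * 'C(N, j) * g t j)%N.
Proof.
transitivity (\sum_(u : cube k) \sum_(v : cube N) g (weight u) (weight v))%N.
  pose h (u : cube k * cube N) : cube (k + N) :=
    [ffun i => match split i with inl a => u.1 a | inr b => u.2 b end].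
  have hl u : lpart (h u) = u.1.
    by apply/ffunP=> i; rewrite !ffunE (unsplitK (inl i)).
  have hr u : rpart (h u) = u.2.
    by apply/ffunP=> i; rewrite !ffunE (unsplitK (inr i)).
  rewrite pair_big /= (reindex h) /=.
    by apply: eq_bigr => u _; rewrite hl hr.
  exists (fun x => (lpart x, rpart x)) => [u _|x _].
    by rewrite hl hr -surjective_pairing.
  apply/ffunP=> i; rewrite ffunE; case: splitP => m mE /=; rewrite ffunE;
    by congr (x _); apply: val_inj; rewrite /= mE.
under eq_bigr do rewrite (sum_weight _ (g _)).
rewrite (sum_weight _ (fun t => \sum_(j < N.+1) 'C(N, j) * g t j)%N).
apply: eq_bigr => t _; rewrite big_distrr; apply: eq_bigr => j _.
by rewrite /= mulnA.
Qed.

(** The edges between layers [j] and [j + 1] of the [N]-cube, called gap [j] below: a point of layer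
    [j] has [N - j] false bits. *)
Definition up_edges (j : nat) : nat := ('C(N, j) * (N - j))%N.

(** Dichromatic edges inside one slice. At [j = N] the value [phi N.+1] gets weight 0. *)
Definition step_count (phi : nat -> bool) : nat :=
  (\sum_(j < N.+1) up_edges j * (phi j != phi j.+1))%N.

Definition differ_count (phi psi : nat -> bool) : nat :=
  (\sum_(j < N.+1) 'C(N, j) * (phi j != psi j))%N.

(** An edge either stays in a slice or joins slices [t] and [t + 1]; each point of slice [t] has
    [k - t] upward edges of the second kind, hence none at [t = k]. *)
Lemma dichromatic_blocks (f : cube (k + N) -> int) (F : nat -> nat -> bool) :
  (forall x, f x = (-1) ^+ F (weight (lpart x)) (weight (rpart x))) ->
  dichromatic f =
  (\sum_(t < k.+1) 'C(k, t) *
     (step_count (F t) + (k - t) * differ_count (F t) (F t.+1)))%N.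
Proof.
move=> fE; rewrite dichromaticE.
transitivity (\sum_(t < k.+1) \sum_(j < N.+1) 'C(k, t) * 'C(N, j) *
     ((k - t) * (F t j != F t.+1 j) + (N - j) * (F t j != F t j.+1)))%N; last first.
  apply: eq_bigr => t _; rewrite mulnDr big_distrr mulnA big_distrr -big_split /=.
  by apply: eq_bigr => j _; rewrite /up_edges; ring.
rewrite -(sum_parts (fun t j =>
   (k - t) * (F t j != F t.+1 j) + (N - j) * (F t j != F t j.+1))%N).
have sgn_neq (b c : bool) : ((-1) ^+ b != (-1) ^+ c :> int) = (b != c).
  by case: b; case: c.
apply: eq_bigr => x _; rewrite big_mkcond big_split_ord /=; congr (_ + _)%N.
  rewrite -card_zeros big_distrl /= [RHS]big_mkcond; apply: eq_bigr => i _.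
  rewrite ffunE; case: ifP => // xi; rewrite mul1n !fE sgn_neq.
  have -> : lpart (flip x (lshift N i)) = flip (lpart x) i.
    by apply/ffunP=> m; rewrite !ffunE (inj_eq (@lshift_inj _ _)).
  have -> : rpart (flip x (lshift N i)) = rpart x.
    by apply/ffunP=> m; rewrite !ffunE eq_rlshift.
  by rewrite weight_flip ?ffunE.
rewrite -card_zeros big_distrl /= [RHS]big_mkcond; apply: eq_bigr => i _.
rewrite ffunE; case: ifP => // xi; rewrite mul1n !fE sgn_neq.
have -> : rpart (flip x (rshift k i)) = flip (rpart x) i.
  by apply/ffunP=> m; rewrite !ffunE (inj_eq (@rshift_inj _ _)).
have -> : lpart (flip x (rshift k i)) = lpart x.
  by apply/ffunP=> m; rewrite !ffunE eq_lrshift.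
by rewrite weight_flip ?ffunE.
Qed.

Lemma weight_parts x : weight x = (weight (lpart x) + weight (rpart x))%N.
Proof.
by rewrite /weight big_split_ord; congr addn; apply: eq_bigr => i _; rewrite ffunE.
Qed.

End BlockCount.

(** * Slice patterns and the gain at a corner *)

Section Slices.
Variable d : nat.
Local Open Scope nat_scope.

(** The sign pattern of a degree [d] polynomial in [j] with one root in each of the gaps
    [m, ..., m + d - 1]; [true] stands for the sign -1. *)
Definition alt m j : bool := odd (minn (j - m) d).

Lemma alt_step m j : (alt m j != alt m j.+1) = (m <= j < m + d).
Proof.
rewrite /alt; have [jm|mj] := ltnP j m.
  have [-> ->] : j - m = 0 /\ j.+1 - m = 0 by split; lia.
  by rewrite min0n.
rewrite subSn //=; have [jd|dj] := ltnP j (m + d).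
  have [-> ->] : minn (j - m) d = j - m /\ minn (j - m).+1 d = (j - m).+1.
    by split; lia.
  by rewrite /=; case: (odd _).
have [-> ->] : minn (j - m) d = d /\ minn (j - m).+1 d = d by split; lia.
by rewrite eqxx.
Qed.

Lemma altS m j : alt m.+1 j.+1 = alt m j.
Proof. by rewrite /alt subSS. Qed.

Lemma alt_shift m j : (alt m j != alt m.+1 j) = (m < j <= m + d).
Proof.
case: j => [|j]; first by rewrite /alt !sub0n min0n.
by rewrite altS eq_sym alt_step; lia.
Qed.

(** Toggling one layer toggles the two gaps beside it: for [d > 0], of the gaps [l, ..., l + d],
    [alt_first] skips only [l + 1] and [alt_last] only [l + d - 1]. *)
Definition alt_first l j : bool := alt l.+1 j (+) (j == l.+1).
Definition alt_last l j : bool := alt l j (+) (j == l + d).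

Lemma neq_addb (a b p q : bool) : (a (+) p != b (+) q) = ((a != b) != (p != q)).
Proof. by case: a; case: b; case: p; case: q. Qed.

Lemma sum_delta M (g : nat -> nat) c :
  c < M -> \sum_(j < M) g j * (j == c :> nat) = g c.
Proof.
move=> cM; rewrite (bigD1 (Ordinal cM)) //= eqxx muln1 big1 ?addn0 // => i.
by rewrite -val_eqE /= => /negbTE->; rewrite muln0.
Qed.

Lemma sum_delta_pred M (g : nat -> nat) c :
  c < M -> \sum_(j < M) g j * (j.+1 == c) = if c is c'.+1 then g c' else 0.
Proof.
case: c => [_|c cM]; first by apply: big1 => i _; rewrite muln0.
by rewrite -[RHS](@sum_delta M) //; lia.
Qed.

(** Two patterns are compared by adding to each the indicators it misses, which avoids truncated
    subtraction. *)
Lemma sum_boolD M (g : nat -> nat) (a b c a' b' c' : nat -> bool) :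
  (forall j, a j + b j + c j = a' j + b' j + c' j) ->
  \sum_(j < M) g j * a j + \sum_(j < M) g j * b j + \sum_(j < M) g j * c j =
  \sum_(j < M) g j * a' j + \sum_(j < M) g j * b' j + \sum_(j < M) g j * c' j.
Proof.
move=> e; rewrite -!big_split; apply: eq_bigr => j _ /=.
by rewrite -!mulnDr e.
Qed.

Variable l : nat.
Hypothesis d_gt0 : 0 < d.
Let N := l.*2 + d.+1.

Let bin_sym a b : a + b = N -> 'C(N, a) = 'C(N, b).
Proof. by move=> ab; rewrite -(@bin_sub N b); [congr binomial|]; lia. Qed.

(** Complementing all bits exchanges gaps [a] and [N - 1 - a]. *)
Let edge_sym a b : a + b = N.-1 -> up_edges N a = up_edges N b.
Proof.
move=> ab; rewrite /up_edges mulnC -mul_bin_left (@bin_sym a.+1 b); last by lia.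
by rewrite mulnC; congr (_ * _); lia.
Qed.

Let edge_last : up_edges N (l + d) = (l + d.+1) * 'C(N, l).
Proof. by rewrite (@edge_sym _ l); [rewrite /up_edges mulnC; congr (_ * _)|]; lia. Qed.

(* [psi] is the slice of [f*] at the corner where all special bits are true, and
   [alt l] is the common neighbouring slice. *)
Lemma corner_true psi k : (forall j, psi j = alt l j.+1) ->
  step_count N (alt_first l) + k * differ_count N (alt l) (alt_first l) +
    k * 'C(N, l) =
  step_count N psi + k * differ_count N (alt l) psi + d.+1 * 'C(N, l).
Proof.
move=> psiE.
have stepE : step_count N (alt_first l) = step_count N psi + d.+1 * 'C(N, l).
  (* Both sides list the gaps from [l - 1] to [l + d]. By symmetry gaps [l + 1] and [l + d - 1]
     cancel; gap [l + d] exceeds gap [l - 1] by [d.+1 * 'C(N, l)]. *)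
  have := @sum_boolD N.+1 (up_edges N)
    (fun j => alt_first l j != alt_first l j.+1) (fun j => j == l.+1)
    (fun j => j.+1 == l)
    (fun j => psi j != psi j.+1) (fun j => j == l + d) (fun j => j == (l + d).-1).
  move=> /(_ _)/wrap[j|/=].
    rewrite !psiE neq_addb !alt_step eqSS.
    case: (boolP (_ < j < _)) => h1; case: (boolP (l <= j.+1 < _)) => h2;
      do ![case: eqP => ? //=]; lia.
  rewrite sum_delta_pred; last by lia.
  rewrite (@sum_delta _ _ l.+1); last by lia.
  rewrite (@sum_delta _ _ (l + d)); last by lia.
  rewrite (@sum_delta _ _ (l + d).-1); last by lia.
  rewrite edge_last (@edge_sym (l + d).-1 l.+1); last by lia.
  rewrite -/(step_count N _) -/(step_count N _).
  (* For [l = 0] gap [l - 1] does not exist and both sides are 0. *)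
  have -> : (if l is l'.+1 then up_edges N l' else 0) = l * 'C(N, l).
    by case: {+}l => // l'; rewrite /up_edges mulnC -mul_bin_left.
  lia.
have differE : differ_count N (alt l) (alt_first l) + 'C(N, l) =
    differ_count N (alt l) psi.
  (* Both sides list the layers from [l] to [l + d]; layers [l + 1] and [l + d] have equal size, so
     only layer [l] remains. *)
  have := @sum_boolD N.+1 (binomial N)
    (fun j => alt l j != alt_first l j) (fun j => j == l) (fun j => j == l.+1)
    (fun j => alt l j != psi j) (fun j => j == l + d) (fun=> false).
  move=> /(_ _)/wrap[j|/=].
    rewrite psiE alt_step -[alt l j]addbF neq_addb alt_shift.
    case: (boolP (l < j <= _)) => h1; case: (boolP (l <= j < _)) => h2;
      do ![case: eqP => ? //=]; lia.
  rewrite !sum_delta; try lia.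
  rewrite (@bin_sym (l + d) l.+1); last by lia.
  rewrite -/(differ_count N _ _) -/(differ_count N _ _).
  under [X in _ = _ + X]eq_bigr do rewrite muln0.
  rewrite big1 //; lia.
by rewrite stepE -differE; lia.
Qed.

(** The mirror image of [corner_true] under complementing all bits, up to a global sign: at [t = 0]
    the slice of [f*] is [alt l.+2], next to [alt l.+1]. *)
Lemma corner_false k :
  step_count N (alt_last l) + k * differ_count N (alt_last l) (alt l.+1) +
    k * 'C(N, l) =
  step_count N (alt l.+2) + k * differ_count N (alt l.+2) (alt l.+1) +
    d.+1 * 'C(N, l).
Proof.
have stepE : step_count N (alt_last l) =
    step_count N (alt l.+2) + d.+1 * 'C(N, l).
  have := @sum_boolD N.+1 (up_edges N)
    (fun j => alt_last l j != alt_last l j.+1) (fun j => j == (l + d).-1)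
    (fun j => j == (l + d).+1)
    (fun j => alt l.+2 j != alt l.+2 j.+1) (fun j => j == l) (fun j => j == l.+1).
  move=> /(_ _)/wrap[j|/=].
    rewrite neq_addb !alt_step.
    case: (boolP (l <= j < _)) => h1; case: (boolP (l.+1 < j < _)) => h2;
      do ![case: eqP => ? //=]; lia.
  rewrite !sum_delta; try lia.
  rewrite (@edge_sym (l + d).-1 l.+1); last by lia.
  rewrite -/(step_count N _) -/(step_count N _).
  have -> : up_edges N l = (l + d.+1) * 'C(N, l) by rewrite -edge_last; apply: edge_sym; lia.
  have -> : up_edges N (l + d).+1 = l * 'C(N, l).
    by rewrite /up_edges mulnC (@bin_sym _ l); [congr (_ * _)|]; lia.
  lia.
have differE : differ_count N (alt_last l) (alt l.+1) + 'C(N, l) =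
    differ_count N (alt l.+2) (alt l.+1).
  have := @sum_boolD N.+1 (binomial N)
    (fun j => alt_last l j != alt l.+1 j) (fun j => j == l + d)
    (fun j => j == (l + d).+1)
    (fun j => alt l.+2 j != alt l.+1 j) (fun j => j == l.+1) (fun=> false).
  move=> /(_ _)/wrap[j|/=].
    rewrite [alt l.+2 j == _]eq_sym alt_shift -[alt l.+1 j]addbF neq_addb alt_shift.
    case: (boolP (l < j <= _)) => h1; case: (boolP (l.+1 < j <= _)) => h2;
      do ![case: eqP => ? //=]; lia.
  rewrite !sum_delta; try lia.
  rewrite (@bin_sym (l + d) l.+1); last by lia.
  rewrite (@bin_sym (l + d).+1 l); last by lia.
  rewrite -/(differ_count N _ _) -/(differ_count N _ _).
  under [X in _ = _ + X]eq_bigr do rewrite muln0.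
  rewrite big1 //; lia.
by rewrite stepE -differE; lia.
Qed.

End Slices.

(** * The edge count of [f*] and its upper bound *)

Section Star.
Variable n : nat.

Lemma dichromatic_weight (f : cube n -> int) (g : nat -> bool) :
  (forall (x : cube n) i, ~~ x i -> (f x != f (flip x i)) = g (weight x)) ->
  dichromatic f = (\sum_(j < n.+1) up_edges n j * g j)%N.
Proof.
move=> fE; rewrite dichromaticE.
transitivity (\sum_(x : cube n) (n - weight x) * g (weight x))%N.
  apply: eq_bigr => x _; rewrite -card_zeros big_distrl /=.
  by apply: eq_bigr => i xi; rewrite fE // mul1n.
rewrite (sum_weight n (fun j => (n - j) * g j)%N); apply: eq_bigr => j _.
by rewrite mulnA.
Qed.

Lemma sum_coord (x : cube n) :
  \sum_(i < n) coord x i = n%:Z - 2 * (weight x)%:Z.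
Proof.
rewrite /weight; have -> : n%:Z = \sum_(i < n) 1 by rewrite sumr_const card_ord natz.
rewrite (big_morph Posz PoszD erefl) mulr_sumr -sumrB.
by apply: eq_bigr => i _; rewrite /coord; case: (x i).
Qed.

(** The flip moves the coordinate sum from [S] to [S' = S - 2]; the only integer of parity opposite
    to [n] between them is [r = S - 1], so only the factor of that root can change sign. *)
Lemma fstar_flip (s : seq int) (x : cube n) i :
  uniq s -> all (opp_parity n) s -> ~~ x i ->
  (fstar s x != fstar s (flip x i)) = (n%:Z - 1 - 2 * (weight x)%:Z \in s).
Proof.
move=> Us /allP sP xi; rewrite /fstar !sum_coord weight_flip //.
set S := n%:Z - _; set S' := n%:Z - _; set r := n%:Z - _ - _.
have prE z : sgz (pstar s).[z] = \prod_(a <- s) sgz (z - a).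
  rewrite /pstar horner_prod (big_morph (@sgz int) (@sgzM int) (@sgz1 int)).
  by apply: eq_bigr => a _; rewrite hornerXsubC.
have par a : a \in s -> a != S /\ a != S'.
  move=> /sP; rewrite /opp_parity /S /S' => par.
  by split; apply: contraNneq par => ->; lia.
have step a : a \in s -> a != r -> sgz (S - a) = sgz (S' - a).
  move=> /par[]; rewrite /S /S' /r; case: sgzP; case: sgzP; lia.
rewrite !prE; have [rs|rs] := boolP (r \in s); last first.
  apply/negbTE; rewrite negbK; apply/eqP; rewrite !big_seq.
  apply: eq_bigr => a a_s; apply: step => //.
  by apply: contraNneq rs => <-.
rewrite !(bigD1_seq r) //=.
have -> : S - r = 1 by rewrite /S /r; lia.
have -> : S' - r = -1 by rewrite /S' /r; lia.
rewrite sgzN1 sgz1 mul1r mulN1r.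
have -> : \prod_(a <- s | a != r) sgz (S - a) = \prod_(a <- s | a != r) sgz (S' - a).
  rewrite !(big_seq_cond (fun a => a != r)); apply: eq_bigr => a /andP[a_s ar].
  exact: step.
(* The other factors are nonzero by parity, so negating their product does change it. *)
have : \prod_(a <- s | a != r) sgz (S' - a) != 0.
  rewrite big_seq_cond; apply: (big_ind (fun z => z != 0)) => // [u v|a /andP[/par[_ aS] _]].
    exact: mulf_neq0.
  by rewrite sgz_eq0 subr_eq0 eq_sym.
by move: (\prod_(a <- s | _) _) => P; lia.
Qed.

Local Open Scope nat_scope.

Lemma bin_leq_half M i j : i <= j -> j.*2 <= M -> 'C(M, i) <= 'C(M, j).
Proof.
elim: j => [|j IHj]; first by rewrite leqn0 => /eqP->.
rewrite leq_eqVlt => /predU1P[-> //|ij] jM; apply: leq_trans (IHj _ _) _; try lia.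
by rewrite -(@leq_pmul2l j.+1) // mul_bin_left leq_mul2r; apply/orP; right; lia.
Qed.

Lemma bin_unimodal M i j : i <= j -> i + j <= M -> 'C(M, i) <= 'C(M, j).
Proof.
move=> ij ijM; have [jM|jM] := leqP j.*2 M; first exact: bin_leq_half.
by rewrite -(@bin_sub M j); [apply: bin_leq_half|]; lia.
Qed.

Lemma up_edgesE j : up_edges n j = n * 'C(n.-1, j).
Proof. by rewrite mul_bin_down mulnC. Qed.

Lemma sum_interval M m d : m + d <= M -> \sum_(j < M) (m <= j < m + d) = d.
Proof.
elim: d => [|d IHd] mM; first by apply: big1 => j _; lia.
rewrite -[in RHS]addn1 -[in RHS]IHd; last by lia.
rewrite -[1](@sum_delta M (fun=> 1) (m + d)); last by lia.
by rewrite -big_split; apply: eq_bigr => j _ /=; lia.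
Qed.

(** Exchange argument: the interval is central, so [th], the size of gap [m], is least inside it and
    at least every gap outside. Adding [th] times the other indicator to each side makes the
    comparison termwise. *)
Lemma interval_sum_max d m (g : nat -> bool) :
  m.*2 + d <= n <= (m.*2 + d).+1 -> 0 < m -> \sum_(j < n.+1) g j <= d ->
  \sum_(j < n.+1) up_edges n j * g j <=
  \sum_(j < n.+1) up_edges n j * (m <= j < m + d).
Proof.
move=> /andP[mn nm] m_gt0 gd; pose th := up_edges n m.
rewrite -(leq_add2r (\sum_(j < n.+1) th * (m <= j < m + d))).
have sumI : \sum_(j < n.+1) (m <= j < m + d) = d.
  by apply: sum_interval; lia.
apply: (@leq_trans (\sum_(j < n.+1) up_edges n j * (m <= j < m + d) +
                    \sum_(j < n.+1) th * g j)); last first.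
  by rewrite leq_add2l -!big_distrr /= sumI leq_mul2l gd orbT.
rewrite -!big_split /=; apply: leq_sum => j _; rewrite /th !up_edgesE.
have [/andP[mj jm]|jI] := boolP (m <= j < m + d); case: (g j); rewrite ?muln1 ?muln0 ?addn0 ?add0n //.
  by rewrite leq_mul2l bin_unimodal ?orbT //; lia.
rewrite leq_mul2l; apply/orP; right.
have [jn|nj] := leqP j n.-1; last by rewrite bin_small.
have [jm|mj] := ltnP j m; first by apply: bin_unimodal; lia.
by rewrite -(@bin_sub n.-1 j) //; apply: bin_unimodal; lia.
Qed.

End Star.

Section Comparison.
Variable n : nat.

(** Each root yields at most one dichromatic gap, and the [d] central gaps carry the most edges. The
    bound is uniform over the admissible [s], so ties between closest roots need no case
    distinction. *)
Lemma fstar_count (s : seq int) d m : (m.*2 + d <= n <= (m.*2 + d).+1)%N ->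
  (0 < m)%N -> closest_roots n d s ->
  (dichromatic (@fstar n s) <=
   \sum_(j < n.+1) up_edges n j * (m <= j < m + d))%N.
Proof.
move=> mn m_gt0 [Us sd sP _].
rewrite (@dichromatic_weight _ _ (fun j => n%:Z - 1 - 2 * j%:Z \in s)); last first.
  by move=> x i xi; apply: fstar_flip.
apply: (@interval_sum_max n d m (fun j => n%:Z - 1 - 2 * j%:Z \in s)) => //; rewrite -sd.
pose r (j : 'I_n.+1) := n%:Z - 1 - 2 * (j : nat)%:Z.
have r_inj : injective r by move=> i j; rewrite /r => rij; apply: val_inj => /=; lia.
rewrite (eq_bigr (fun j => if r j \in s then 1 else 0)%N); last first.
  by move=> j _; case: (_ \in _).
rewrite -big_mkcond /= sum1_card cardE -(size_map r).
apply: uniq_leq_size; first by rewrite map_inj_uniq ?enum_uniq.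
by move=> a /mapP[j]; rewrite mem_enum => js ->.
Qed.

Lemma alt_count d m :
  dichromatic (fun x : cube n => (-1) ^+ alt d m (weight x)) =
  (\sum_(j < n.+1) up_edges n j * (m <= j < m + d))%N.
Proof.
rewrite (@dichromatic_weight _ _ (fun j => (m <= j < m + d)%N)) // => x i xi.
rewrite weight_flip // -alt_step.
by case: alt; case: alt.
Qed.

End Comparison.

(** * Edge count of the modified function *)

Definition blockfun k N (F : nat -> nat -> bool) (x : cube (k + N)) : int :=
  (-1) ^+ F (weight (lpart x)) (weight (rpart x)).

Lemma sum_bin2 (V X : nat -> nat) :
  (\sum_(t < 3) 'C(2, t) * (V t + (2 - t) * X t) =
   V 0 + 2 * X 0 + 2 * (V 1 + X 1) + V 2)%N.
Proof.
rewrite !big_ord_recr big_ord0 /=.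
by rewrite bin0 bin1 binn; lia.
Qed.

Lemma sum_bin3 (V X : nat -> nat) :
  (\sum_(t < 4) 'C(3, t) * (V t + (3 - t) * X t) =
   V 0 + 3 * X 0 + 3 * (V 1 + 2 * X 1) + 3 * (V 2 + X 2) + V 3)%N.
Proof.
rewrite !big_ord_recr big_ord0 /=.
by rewrite bin0 bin1 binSn binn; lia.
Qed.

Section Gain.
Variables d l : nat.
Hypothesis d_gt0 : (0 < d)%N.
Let N := (l.*2 + d.+1)%N.

Definition slice2 (t : nat) : nat -> bool :=
  match t with 0 => alt d l.+1 | 1 => alt d l | _ => alt_first d l end.

Definition slice3 (t : nat) : nat -> bool :=
  match t with
  | 0 => alt_last d l | 1 => alt d l.+1 | 2 => alt d l | _ => alt_first d l
  end.

Lemma dichromatic_alt_blocks k m :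
  dichromatic (fun x : cube (k + N) => (-1) ^+ alt d m (weight x)) =
  (\sum_(t < k.+1) 'C(k, t) *
     (step_count N (fun j => alt d m (t + j)) +
      (k - t) * differ_count N (fun j => alt d m (t + j))
                               (fun j => alt d m (t.+1 + j))))%N.
Proof.
apply: (dichromatic_blocks (F := fun t j => alt d m (t + j))) => x.
by rewrite weight_parts.
Qed.

(** In total weight, [alt d l.+1] has the slices [alt l.+1], [alt l] and a shifted [alt l]; only the
    last, at the single corner [t = 2], is replaced. *)
Lemma gain2 :
  (dichromatic (@blockfun 2 N slice2) + 2 * 'C(N, l) =
   dichromatic (fun x : cube (2 + N) => (-1) ^+ alt d l.+1 (weight x)) +
   d.+1 * 'C(N, l))%N.
Proof.
rewrite dichromatic_alt_blocks (dichromatic_blocks (F := slice2)) //.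
rewrite (sum_bin2 (fun t => step_count N (slice2 t))
                  (fun t => differ_count N (slice2 t) (slice2 t.+1))).
rewrite (sum_bin2 (fun t => step_count N (fun j => alt d l.+1 (t + j)))
                  (fun t => differ_count N (fun j => alt d l.+1 (t + j))
                                           (fun j => alt d l.+1 (t.+1 + j)))).
have := @corner_true d l d_gt0 (fun j => alt d l.+1 (2 + j)) 2 (fun=> erefl).
rewrite -/N /slice2.
rewrite -[fun j => alt d l.+1 (0 + j)]/(alt d l.+1).
rewrite -[fun j => alt d l.+1 (1 + j)]/(alt d l).
lia.
Qed.

(** Both corners [t = 0] and [t = 3] have binomial weight 1, and each gains [d + 1 - 3] times
    ['C(N, l)]. *)
Lemma gain3 :
  (dichromatic (@blockfun 3 N slice3) + 6 * 'C(N, l) =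
   dichromatic (fun x : cube (3 + N) => (-1) ^+ alt d l.+2 (weight x)) +
   2 * d.+1 * 'C(N, l))%N.
Proof.
rewrite dichromatic_alt_blocks (dichromatic_blocks (F := slice3)) //.
rewrite (sum_bin3 (fun t => step_count N (slice3 t))
                  (fun t => differ_count N (slice3 t) (slice3 t.+1))).
rewrite (sum_bin3 (fun t => step_count N (fun j => alt d l.+2 (t + j)))
                  (fun t => differ_count N (fun j => alt d l.+2 (t + j))
                                           (fun j => alt d l.+2 (t.+1 + j)))).
have := @corner_true d l d_gt0 (fun j => alt d l.+2 (3 + j)) 3 (fun=> erefl).
have := @corner_false d l d_gt0 3.
rewrite -/N /slice3.
rewrite -[fun j => alt d l.+2 (0 + j)]/(alt d l.+2).
rewrite -[fun j => alt d l.+2 (1 + j)]/(alt d l.+1).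
rewrite -[fun j => alt d l.+2 (2 + j)]/(alt d l).
lia.
Qed.

End Gain.

(** * The modified function is a PTF *)

(** [K] exceeds every ratio [|q y| / |b y|]; points with [b y = 0] add 0 to the sum, since division
    by zero gives 0. *)
Lemma large_multiplier (R : realFieldType) (T : finType) (b q : T -> R) :
  exists K : R, forall x,
    sgz (K * b x + q x) = if b x == 0 then sgz (q x) else sgz (b x).
Proof.
exists (1 + \sum_y `|q y| / `|b y|) => x; set K := 1 + _.
case: eqVneq => [->|b0]; first by rewrite mulr0 add0r.
have nb : 0 < `|b x| by rewrite normr_gt0.
have qK : `|q x| < K * `|b x|.
  rewrite -ltr_pdivrMr // /K (bigD1 x) //= addrA addrAC ltrDr.
  by apply: ltr_wpDr => //; apply: sumr_ge0 => y _; apply: divr_ge0.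
have := ler_norm (q x); have := ler_norm (- q x); rewrite normrN => q1 q2.
have [bx|bx|bx] := sgzP (b x); first by rewrite bx eqxx in b0.
  by apply: gtr0_sgz; rewrite (gtr0_norm bx) in qK; lra.
by apply: ltr0_sgz; rewrite (ltr0_norm bx) mulrN in qK; lra.
Qed.

Section RisingProducts.
Variables (R : realFieldType) (d : nat).

(* For [i >= d] nothing is omitted: [rise d] is the full product. *)
Definition rise (i : nat) : {poly R} :=
  \prod_(m < d | m != i :> nat) ('X - (- m%:R)%:P).

(** The derivative of [rise d]. At the node [- m%:R] only the summand [rise m] survives, so the
    signs alternate along the nodes. *)
Definition rise_sum : {poly R} := \sum_(i < d) rise i.

Lemma riseE i z : (rise i).[z] = \prod_(m < d | m != i :> nat) (z + m%:R).
Proof.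
by rewrite horner_prod; apply: eq_bigr => m _; rewrite hornerXsubC opprK.
Qed.

Lemma rise_gt0 i z : 0 < z -> 0 < (rise i).[z].
Proof.
by move=> z0; rewrite riseE; apply: prodr_gt0 => m _; apply: ltr_wpDr.
Qed.

Lemma rise_root i m : (m < d)%N -> m != i -> (rise i).[- m%:R] = 0.
Proof.
by move=> md mi; rewrite riseE (bigD1 (Ordinal md)) //= addNr mul0r.
Qed.

Lemma rise_sumE m : (m < d)%N -> rise_sum.[- m%:R] = (rise m).[- m%:R].
Proof.
move=> md; rewrite horner_sum (bigD1 (Ordinal md)) //= big1 ?addr0 // => i.
by rewrite -val_eqE eq_sym => /= mi; apply: rise_root.
Qed.

(** The negative factors are those with [m < minn i d]. The case [i < d] gives the signs at the
    nodes, the case [i >= d] the sign of the full product beyond them. *)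
Lemma rise_sign i :
  sgz (rise (minn i d)).[- i%:R] = (-1) ^+ minn i d.
Proof.
rewrite riseE (big_morph (@sgz R) (@sgzM R) (@sgz1 R)).
transitivity (\prod_(m < d) (if (m < minn i d)%N then -1 else 1 : int)).
  rewrite big_mkcond; apply: eq_bigr => m _; have md := ltn_ord m.
  case: (ltngtP m (minn i d)) => //= mi.
    by apply: ltr0_sgz; rewrite addrC subr_lt0 ltr_nat; lia.
  by apply: gtr0_sgz; rewrite addrC subr_gt0 ltr_nat; lia.
have : (minn i d <= d)%N by lia.
move: (minn i d) => a; elim: {+}d => [|e IHe] ae.
  by rewrite big_ord0; have -> : a = 0%N by lia.
rewrite big_ord_recr /=; have [ea|ea] := ltnP e a; last by rewrite IHe // mulr1.
have -> : a = e.+1 by lia.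
rewrite (eq_bigr (fun=> -1)) => [|m _]; last by rewrite ltnS ltnW.
by rewrite prodr_const card_ord exprSr.
Qed.

Let roots i : seq R := [seq - m%:R | m <- iota 0 d & m != i].

Let rise_roots i : rise i = \prod_(a <- roots i) ('X - a%:P).
Proof.
rewrite big_map big_filter.
by rewrite /rise -(big_mkord (fun m => m != i) (fun m => 'X - (- m%:R)%:P)) /index_iota subn0.
Qed.

Let size_roots i : size (roots i) = (d - (i < d))%N.
Proof.
rewrite size_map size_filter; have := count_predC (pred1 i) (iota 0 d).
rewrite size_iota (count_uniq_mem _ (iota_uniq _ _)) mem_iota /=.
rewrite (eq_count (a2 := fun m => m != i)) //; lia.
Qed.

Lemma size_rise i : (size (rise i) <= d.+1)%N.
Proof. by rewrite rise_roots size_prod_XsubC size_roots; lia. Qed.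

Lemma size_rise_lt i : (i < d)%N -> size (rise i) = d.
Proof. by move=> id; rewrite rise_roots size_prod_XsubC size_roots id; lia. Qed.

Lemma rise_lead i : (i < d)%N -> (rise i)`_d.-1 = 1.
Proof.
move=> id; have := @lead_coef_prod_XsubC R _ (roots i) xpredT (fun a => a).
by rewrite -rise_roots lead_coefE size_rise_lt.
Qed.

(** By Vieta this is the sum of the [m < d] other than [i], and all of them sum to ['C(d, 2)]. *)
Lemma rise_sublead i : (1 < d)%N -> (i < d)%N ->
  (rise i)`_d.-2 = 'C(d, 2)%:R - i%:R.
Proof.
move=> d1 id; have := @coefPn_prod_XsubC R (roots i).
rewrite -rise_roots size_roots id subn1 => -> //; last by lia.
rewrite big_map big_filter -sumrN.
under eq_bigr do rewrite opprK.
rewrite -bin2_sum natr_sum [in RHS](bigD1_seq i) /= ?mem_index_iota ?iota_uniq //.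
by rewrite addrAC subrr add0r /index_iota subn0.
Qed.

End RisingProducts.

Section BlockPTF.
Variables (R : realFieldType) (d l k : nat).
Let N := (l.*2 + d.+1)%N.
Implicit Types x : cube (k + N).

Let bitE (b : bool) : b%:R = (1 - ((-1) ^+ b)%:~R) / 2 :> R.
Proof. by case: b => /=; rewrite ?expr1 ?expr0; lra. Qed.

Let polyfun_bit (i : 'I_(k + N)) :
  polyfun 1 (fun x : cube (k + N) => ((x i : bool) : nat)%:R : R).
Proof.
apply: (@eq_polyfun _ _ _ (fun x => 2^-1 + - 2^-1 * (coord x i)%:~R)).
  by move=> x; rewrite bitE /coord; lra.
apply: polyfunD; first exact: polyfun_cst.
exact/polyfunZ/polyfun_coord.
Qed.

Lemma polyfun_lweight : polyfun 1 (fun x => (weight (lpart x))%:R : R).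
Proof.
apply: (@eq_polyfun _ _ _ (fun x => \sum_i (x (lshift N i) : nat)%:R)).
  by move=> x; rewrite /weight natr_sum; apply: eq_bigr => i _; rewrite ffunE.
by apply: polyfun_sum => i; apply: polyfun_bit.
Qed.

Lemma polyfun_rweight : polyfun 1 (fun x => (weight (rpart x))%:R : R).
Proof.
apply: (@eq_polyfun _ _ _ (fun x => \sum_i (x (rshift k i) : nat)%:R)).
  by move=> x; rewrite /weight natr_sum; apply: eq_bigr => i _; rewrite ffunE.
by apply: polyfun_sum => i; apply: polyfun_bit.
Qed.

(** The shift and the sign put the middle layers [l + 1, ..., l + d] at the roots
    [0, -1, ..., 1 - d] of [rise d]. *)
Definition layer x : R := l.+1%:R - (weight (rpart x))%:R.

Lemma polyfun_layer : polyfun 1 layer.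
Proof.
apply: (@eq_polyfun _ _ _ (fun x => l.+1%:R + -1 * (weight (rpart x))%:R)).
  by move=> x; rewrite mulN1r.
by apply: polyfunD; [apply: polyfun_cst | apply/polyfunZ/polyfun_rweight].
Qed.

(* The multiple of [rise d] dominates off the layers [l < j <= l + d], where it
   vanishes and the sign is that of [q]. *)
Lemma blockfun_PTF (F : nat -> nat -> bool) (q : cube (k + N) -> R) :
  polyfun d q ->
  (forall t j, ~~ (l < j <= l + d)%N -> F t j = alt d l.+1 j) ->
  (forall x i, (i < d)%N -> layer x = - i%:R ->
     sgz (q x) = (-1) ^+ F (weight (lpart x)) (l.+1 + i)%N) ->
  PTF R d (@blockfun k N F).
Proof.
move=> dq Fout Fin.
have [K KE] := large_multiplier (fun x => (rise R d d).[layer x]) q.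
apply: (@polyfun_PTF _ _ _ _ (fun x => K * (rise R d d).[layer x] + q x)).
- by move=> x; rewrite /blockfun; case: (F _ _); [right|left].
- apply: polyfunD => //; apply/polyfunZ/polyfun_horner; first exact: size_rise.
  exact: polyfun_layer.
move=> x; rewrite KE /blockfun; move: (Fin x); rewrite /layer.
set j := weight (rpart x) => {}Fin.
have [jl|lj] := leqP j l.
  have z0 : 0 < l.+1%:R - j%:R :> R by rewrite subr_gt0 ltr_nat.
  have := rise_gt0 d d z0 => r0; rewrite gt_eqF // gtr0_sgz // Fout; last by lia.
  have jl0 : (j - l.+1 = 0)%N by lia.
  by rewrite /alt jl0 min0n.
have [i jE] : exists i, j = (l.+1 + i)%N by exists (j - l.+1)%N; lia.
have zE : l.+1%:R - j%:R = - i%:R :> R by rewrite jE natrD; lra.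
rewrite zE in Fin *; have [di|id] := leqP d i; last first.
  by rewrite jE -Fin // rise_root ?eqxx //; lia.
have := rise_sign R d i; have -> : minn i d = d by lia.
move=> rE; rewrite -sgz_eq0 rE expf_eq0 /= oppr_eq0 oner_eq0 andbF.
rewrite Fout; last by lia.
by rewrite /alt jE addKn (minn_idPr di) signr_odd.
Qed.

End BlockPTF.

Lemma size_leq_pred (R : nzRingType) (p : {poly R}) e :
  (size p <= e.+1)%N -> p`_e = 0 -> (size p <= e)%N.
Proof.
move=> /leq_sizeP sp pe; apply/leq_sizeP => j; rewrite leq_eqVlt.
by move=> /predU1P[<- //|]; apply: sp.
Qed.

Section SlicePTF.
Variables (R : realFieldType) (d l : nat).
Local Notation rise := (rise R d).
Local Notation E := (rise_sum R d).

Let size_E : (size E <= d)%N.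
Proof.
by apply: leq_trans (size_sum _ _ _) _; apply/bigmax_leqP => i _; rewrite size_rise_lt.
Qed.

Let lead_E : E`_d.-1 = d%:R.
Proof.
rewrite coef_sum (eq_bigr (fun=> 1)) ?sumr_const ?card_ord // => i _.
exact: rise_lead.
Qed.

Let sublead_E : (1 < d)%N -> E`_d.-2 = d%:R * 'C(d, 2)%:R - 'C(d, 2)%:R.
Proof.
move=> d1; rewrite coef_sum (eq_bigr (fun i : 'I_d => 'C(d, 2)%:R - (i : nat)%:R)).
  rewrite sumrB sumr_const card_ord -natr_sum -bin2_sum.
  by rewrite !(big_mkord xpredT (fun i => i)) mulr_natl.
by move=> i _; apply: rise_sublead.
Qed.

(** [E] is a sum of [d] monic polynomials of degree [d - 1], so the leading terms cancel; the degree
    lost pays for a factor quadratic in [t]. *)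
Lemma size_quadratic_part : (1 < d)%N ->
  (size (E - d%:R *: rise 0)%R <= d.-1)%N.
Proof.
move=> d1; apply: size_leq_pred.
  rewrite prednK; last by lia.
  apply: leq_trans (size_polyD _ _) _; rewrite geq_max size_E size_polyN.
  by apply: leq_trans (size_scale_leq _ _) _; rewrite size_rise_lt; lia.
by rewrite coefB coefZ lead_E rise_lead ?mulr1 ?subrr //; lia.
Qed.

Lemma size_antisymmetric_part : (1 < d)%N ->
  (size (rise d.-1 - rise 0)%R <= d.-1)%N.
Proof.
move=> d1; apply: size_leq_pred.
  rewrite prednK; last by lia.
  apply: leq_trans (size_polyD _ _) _; rewrite geq_max size_polyN.
  by rewrite !size_rise_lt; lia.
by rewrite coefB !rise_lead ?subrr //; lia.
Qed.

(** A factor cubic in [t] needs two cancellations: the leading coefficients are both [2 * d], and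
    the next ones agree because [2 * 'C(d, 2) = d * (d - 1)]. *)
Lemma size_cubic_part : (1 < d)%N ->
  (size (d%:R *: (rise 0 + rise d.-1) - 2 *: E)%R <= d.-2)%N.
Proof.
move=> d1; apply: size_leq_pred; first apply: size_leq_pred.
- have -> : d.-2.+2 = d by lia.
  apply: leq_trans (size_polyD _ _) _; rewrite geq_max size_polyN.
  rewrite !(leq_trans (size_scale_leq _ _)) //.
  by apply: leq_trans (size_polyD _ _) _; rewrite geq_max !size_rise_lt; lia.
- have -> : d.-2.+1 = d.-1 by lia.
  by rewrite coefB !coefZ coefD lead_E !rise_lead; [lra|lia|lia].
rewrite coefB !coefZ coefD sublead_E // !rise_sublead //; try lia.
have C2 : 2 * 'C(d, 2)%:R = d%:R * d.-1%:R :> R.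
  by rewrite -!natrM; congr _%:R; rewrite mul_bin_left bin1; lia.
have -> : d%:R * ('C(d, 2)%:R - 0%:R + ('C(d, 2)%:R - d.-1%:R)) -
    2 * (d%:R * 'C(d, 2)%:R - 'C(d, 2)%:R) = 2 * 'C(d, 2)%:R - d%:R * d.-1%:R :> R by ring.
by rewrite C2 subrr.
Qed.

Let rise0 i : (i < d)%N -> (rise 0).[- i%:R] = (i == 0%N)%:R * (rise i).[- i%:R].
Proof.
by case: eqVneq => [-> _|i0 id]; rewrite ?mul1r // rise_root ?mul0r.
Qed.

Let rise_last i : (i < d)%N ->
  (rise d.-1).[- i%:R] = (i == d.-1)%:R * (rise i).[- i%:R].
Proof.
by case: eqVneq => [-> _|i0 id]; rewrite ?mul1r // rise_root ?mul0r.
Qed.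

Let rise_diag i : (i < d)%N -> sgz (rise i).[- i%:R] = (-1) ^+ odd i.
Proof.
by move=> id; have := rise_sign R d i; rewrite (minn_idPl (ltnW id)) signr_odd.
Qed.

Let altE i : (i < d)%N -> alt d l.+1 (l.+1 + i) = odd i.
Proof. by move=> id; rewrite /alt addKn (minn_idPl (ltnW id)). Qed.

Let altE' i : (i < d)%N -> alt d l (l.+1 + i) = ~~ odd i.
Proof. by move=> id; rewrite /alt addSnnS addKn (minn_idPl id). Qed.

Let alt_out j : ~~ (l < j <= l + d)%N -> alt d l j = alt d l.+1 j.
Proof. by rewrite -alt_shift negbK => /eqP. Qed.

Let sgz_scale (c e : R) (b : bool) : sgz e = (-1) ^+ b ->
  (0 < c -> sgz (c * e) = (-1) ^+ b) /\ (c < 0 -> sgz (c * e) = (-1) ^+ ~~ b).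
Proof.
move=> eb; split=> c0; rewrite sgzM eb; first by rewrite gtr0_sgz ?mul1r.
by rewrite ltr0_sgz //; case: (b).
Qed.

Local Notation N := (l.*2 + d.+1)%N.

Lemma slice2_PTF : (1 < d)%N -> PTF R d (@blockfun 2 N (slice2 d l)).
Proof.
move=> d1.
pose t (x : cube (2 + N)) : R := (weight (lpart x))%:R.
have dt : polyfun 1 t by apply: polyfun_lweight.
have dz := polyfun_layer R d l 2.
(* [q] takes the values [E], [- E], [E - 4 d rise 0] at [t = 0, 1, 2]. *)
pose q x := (1 + -2 * t x) * E.[layer R x] +
  t x * (2 * (t x + -1)) * (E - d%:R *: rise 0).[layer R x].
apply: (blockfun_PTF (q := q)).
- apply: polyfunD.
    apply: (@polyfun_leq _ _ (1 + d.-1)); first by lia.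
    apply: polyfunM; last first.
      by apply: polyfun_horner => //; rewrite prednK ?size_E; lia.
    by apply: polyfunD; [apply: polyfun_cst|apply: polyfunZ].
  apply: (@polyfun_leq _ _ (1 + 1 + d.-2)); first by lia.
  apply: polyfunM; last first.
    apply: polyfun_horner => //; apply: leq_trans (size_quadratic_part d1) _; lia.
  apply: polyfunM => //; apply/polyfunZ/polyfunD => //; exact: polyfun_cst.
- move=> [|[|s]] j jo //=; first exact: alt_out.
  rewrite /alt_first; case: eqVneq jo => [->|]; last by rewrite addbF.
  lia.
move=> x i id zE; rewrite /q zE hornerD hornerN hornerZ rise_sumE // rise0 //.
have tw : (weight (lpart x) <= 2)%N by apply: weight_leq.
rewrite /t; case: (weight (lpart x)) tw => [|[|[|w]]] // _ /=;
  set e := (rise i).[_].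
- rewrite mulr0 addr0 !mul0r mul1r addr0 altE //; exact: rise_diag.
- rewrite altE' //; rewrite -(proj2 (sgz_scale (-1) (rise_diag id))); last by lra.
  by congr sgz; rewrite -/e /=; ring.
have d0 : 1 <= d%:R :> R by rewrite ler1n; lia.
rewrite /alt_first altE //; case: eqVneq => [i0|i0].
  have -> : ((l.+1 + i)%N == l.+1) by lia.
  rewrite addbT; rewrite -(proj2 (sgz_scale (1 - 4 * d%:R) (rise_diag id))); last by lra.
  by congr sgz; rewrite -/e /=; ring.
have -> : ((l.+1 + i)%N == l.+1) = false by lia.
rewrite addbF -rise_diag //; congr sgz; rewrite -/e /=; ring.
Qed.

Lemma slice3_PTF : (2 < d)%N -> PTF R d (@blockfun 3 N (slice3 d l)).
Proof.
move=> d2; have d1 : (1 < d)%N by lia.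
pose t (x : cube (3 + N)) : R := (weight (lpart x))%:R.
have dt : polyfun 1 t by apply: polyfun_lweight.
have dz := polyfun_layer R d l 3.
pose u x := 3 + -2 * t x; pose v x := (t x + -1) * (t x + -2).
have du : polyfun 1 u.
  by apply: polyfunD; [apply: polyfun_cst|apply: polyfunZ].
have dv : polyfun 2 v.
  by apply: (@polyfunM _ _ 1 1); apply: polyfunD => //; apply: polyfun_cst.
(* [q / 3] takes the values [4 d rise d.-1 - E], [E], [- E], [E - 4 d rise 0]
   at [t = 0, 1, 2, 3]. *)
pose q x := 3 * u x * E.[layer R x] +
  (3 * d%:R * v x * (rise d.-1 - rise 0).[layer R x] +
   u x * v x * (d%:R *: (rise 0 + rise d.-1) - 2 *: E).[layer R x]).
apply: (blockfun_PTF (q := q)).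
- apply: polyfunD; last apply: polyfunD.
  + apply: (@polyfun_leq _ _ (1 + d.-1)); first by lia.
    apply: polyfunM; first exact: polyfunZ.
    by apply: polyfun_horner => //; rewrite prednK ?size_E; lia.
  + apply: (@polyfun_leq _ _ (2 + d.-2)); first by lia.
    apply: polyfunM; first exact: polyfunZ.
    apply: polyfun_horner => //; apply: leq_trans (size_antisymmetric_part d1) _; lia.
  (* The degree [3 + (d - 3)] fits because [d > 2]. *)
  + apply: (@polyfun_leq _ _ (1 + 2 + d.-2.-1)); first by lia.
    apply: polyfunM; first exact: polyfunM.
    apply: polyfun_horner => //; apply: leq_trans (size_cubic_part d1) _; lia.
- move=> [|[|[|s]]] j jo //=; last 2 first.
  + exact: alt_out.
  + rewrite /alt_first; case: eqVneq jo => [->|]; last by rewrite addbF.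
    lia.
  rewrite /alt_last alt_out //; case: eqVneq jo => [->|]; last by rewrite addbF.
  lia.
move=> x i id zE; rewrite /q zE !(hornerD, hornerN, hornerZ) rise_sumE //.
rewrite rise0 // rise_last //.
have tw : (weight (lpart x) <= 3)%N by apply: weight_leq.
have d0 : 1 <= d%:R :> R by rewrite ler1n; lia.
rewrite /u /v /t; case: (weight (lpart x)) tw => [|[|[|[|w]]]] // _ /=;
  set e := (rise i).[_].
- rewrite /alt_last altE' //; case: eqVneq => [i0|i0].
    have -> : ((l.+1 + i)%N == (l + d)%N) by lia.
    rewrite addbT negbK.
    rewrite -(proj1 (sgz_scale (12 * d%:R - 3) (rise_diag id))); last by lra.
    by congr sgz; rewrite -/e /=; ring.
  have -> : ((l.+1 + i)%N == (l + d)%N) = false by lia.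
  rewrite addbF; rewrite -(proj2 (sgz_scale (- 3) (rise_diag id))); last by lra.
  by congr sgz; rewrite -/e /=; ring.
- rewrite altE //; rewrite -(proj1 (sgz_scale (3) (rise_diag id))); last by lra.
  by congr sgz; rewrite -/e /=; ring.
- rewrite altE' //; rewrite -(proj2 (sgz_scale (- 3) (rise_diag id))); last by lra.
  by congr sgz; rewrite -/e /=; ring.
rewrite /alt_first altE //; case: (eqVneq i 0%N) => [i0|i0].
  have -> : ((l.+1 + i)%N == l.+1) by lia.
  rewrite addbT; rewrite -(proj2 (sgz_scale (3 - 12 * d%:R) (rise_diag id))); last by lra.
  by congr sgz; rewrite -/e /=; ring.
have -> : ((l.+1 + i)%N == l.+1) = false by lia.
rewrite addbF; rewrite -(proj1 (sgz_scale (3) (rise_diag id))); last by lra.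
by congr sgz; rewrite -/e /=; ring.
Qed.

End SlicePTF.

(** * Size of the gain *)

From mathcomp Require Import reals sequences exp.

Section CentralBinomial.
Variable R : realType.

(** The bound [(1 + t / 2) ^+ 8 <= expR (4 * t)] reduces this to a polynomial inequality. *)
Lemma ratio_leq_expR (t : R) : 0 <= t <= 7 / 8 -> 1 + t <= (1 - t) * expR (4 * t).
Proof.
move=> /andP[t0 t1].
have a_le : (1 + t / 2) ^+ 8 <= expR (4 * t).
  have -> : 4 * t = 8%:R * (t / 2) by lra.
  rewrite expRM_natl lerXn2r ?nnegrE ?expR_ge0 ?expR_ge1Dx //; lra.
(* [b] is [(1 + t / 2) ^+ 4] without its last term [t ^+ 4 / 16]. *)
pose b := 1 + 2 * t + 3 / 2 * t ^+ 2 + t ^+ 3 / 2.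
have b_le : b ^+ 2 <= (1 + t / 2) ^+ 8.
  rewrite (exprM _ 4 2) lerXn2r ?nnegrE ?exprn_ge0 //; try lra.
    by rewrite /b; have := exprn_ge0 2 t0; have := exprn_ge0 3 t0; lra.
  have -> : (1 + t / 2) ^+ 4 = b + t ^+ 4 / 16 by rewrite /b; field.
  by rewrite lerDl divr_ge0 ?exprn_ge0.
(* These bounds replace the powers of [t] from the third on by multiples of [t], leaving a linear
   inequality. *)
have t_le e c : t ^+ e <= c -> t ^+ e.+1 <= t * c.
  by move=> ?; rewrite exprS ler_wpM2l.
have t_ub e : t ^+ e <= (7 / 8) ^+ e by rewrite lerXn2r // ?nnegrE; lra.
have := t_le _ _ (t_ub 2); have := t_le _ _ (t_ub 3).
have := t_le _ _ (t_ub 4); have := t_le _ _ (t_ub 5) => h6 h5 h4 h3.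
have key : 1 + t <= (1 - t) * b ^+ 2.
  rewrite -subr_ge0; have -> : (1 - t) * b ^+ 2 - (1 + t) =
    t * (2 + 3 * t - (11 / 4 * t ^+ 3 + 11 / 4 * t ^+ 4 + 5 / 4 * t ^+ 5 +
      t ^+ 6 / 4)) by rewrite /b; field.
  apply: mulr_ge0 => //.
  by move: h3 h4 h5 h6; rewrite !exprS expr0; lra.
apply: le_trans key _; rewrite ler_wpM2l ?(le_trans b_le) //; lra.
Qed.

Lemma two_leq_expR : 2 <= expR (3 / 4 : R).
Proof.
have -> : 3 / 4 = 8%:R * (3 / 32) :> R by lra.
rewrite expRM_natl; apply: (@le_trans _ _ ((1 + 3 / 32) ^+ 8)); first by rewrite !exprS expr0; lra.
by rewrite lerXn2r ?nnegrE ?expR_ge0 ?expR_ge1Dx //; lra.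
Qed.

Let gauss N i : R := expR ((N%:R - 2 * i%:R) ^+ 2 / N%:R).

(** The quotient of the binomials is [(1 + t) / (1 - t)] with [t = u / (N + 1)], and [N <= 16 * i]
    keeps [t <= 7 / 8]; the Gaussian exponent drops by [4 * (u / N)], at least [4 * t]. *)
Lemma bin_gauss_step N i : (i.+1.*2 <= N)%N -> (N <= 16 * i)%N ->
  'C(N, i.+1)%:R * gauss N i.+1 <= 'C(N, i)%:R * gauss N i.
Proof.
move=> iN Ni; have N0 : 0 < N%:R :> R by rewrite ltr0n; lia.
pose u : R := N%:R - 2 * i%:R - 1; pose t := u / (N%:R + 1).
have iNR : 2 * i%:R + 2 <= N%:R :> R.
  by rewrite -natrM -natrD ler_nat; lia.
have NiR : N%:R <= 16 * i%:R :> R by rewrite -natrM ler_nat.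
have i0 : 0 <= i%:R :> R by [].
have t01 : 0 <= t <= 7 / 8.
  apply/andP; split; first by apply: divr_ge0; rewrite /u; lra.
  by rewrite /t ler_pdivrMr /u; lra.
have := ratio_leq_expR t01 => tE.
have cE : (1 - t) * 'C(N, i.+1)%:R = (1 + t) * 'C(N, i)%:R.
  have := congr1 (fun m => m%:R : R) (mul_bin_left N i).
  rewrite !natrM natrB ?natr1 -?[i.+1%:R]natr1; last by lia.
  move=> bE; have -> : 1 - t = 2 * (i%:R + 1) / (N%:R + 1) by rewrite /t /u; field; lra.
  have -> : 1 + t = 2 * (N%:R - i%:R) / (N%:R + 1) by rewrite /t /u; field; lra.
  rewrite mulrAC [RHS]mulrAC -!mulrA; congr (2 * _); rewrite !mulrA; congr (_ / _).
  by rewrite -bE natr1.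
have t_lt1 : 0 < 1 - t by case/andP: t01; lra.
have step : 'C(N, i.+1)%:R <= 'C(N, i)%:R * expR (4 * t).
  rewrite -(ler_pM2l t_lt1) cE mulrCA [leLHS]mulrC ler_wpM2l //.
apply: le_trans (ler_wpM2r (expR_ge0 _) step) _.
rewrite -mulrA ler_wpM2l // -expRD ler_expR.
have -> : (N%:R - 2 * i%:R) ^+ 2 / N%:R =
    4 * (u / N%:R) + (N%:R - 2 * i.+1%:R) ^+ 2 / N%:R.
  by rewrite /u -natr1; field; lra.
rewrite lerD2r ler_wpM2l // /t ler_wpM2l ?lef_pV2 ?posrE; rewrite /u; lra.
Qed.

Lemma bin_leq_exp2 N i : ('C(N, i) <= 2 ^ N)%N.
Proof.
elim: N i => [|N IHN] [|i] //; first by rewrite bin0 expn_gt0.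
by rewrite binS expnS mul2n -addnn leq_add.
Qed.

(** For [N <= 16 * l] the steps chain up to the middle, where the Gaussian factor is at least 1. For
    smaller [l] that factor alone is at least [2 ^ N], since [(7/8)^2 >= 3/4] and
    [2 <= expR (3/4)]. *)
Lemma central_bin_leq N l : (0 < N)%N -> (l.*2 <= N)%N ->
  'C(N, N./2)%:R <= 'C(N, l)%:R * gauss N l.
Proof.
move=> N_gt0 lN; have N0 : 0 < N%:R :> R by rewrite ltr0n.
have [Nl|lN16] := leqP N (16 * l).
  have le_chain m : (l <= m)%N -> (m.*2 <= N)%N ->
      'C(N, m)%:R * gauss N m <= 'C(N, l)%:R * gauss N l.
    elim: m => [|m IHm]; first by rewrite leqn0 => /eqP->.
    rewrite leq_eqVlt => /predU1P[<- //|lm] mN.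
    by apply: le_trans (IHm _ _); [apply: bin_gauss_step|..]; lia.
  apply: le_trans (le_chain N./2 _ _); [|lia|lia].
  rewrite ler_peMr // -[leLHS]expR0 ler_expR.
  by rewrite divr_ge0 ?sqr_ge0 // ltW.
have lR : 16 * l%:R <= N%:R :> R by rewrite -natrM ler_nat ltnW.
have l0 : 0 <= l%:R :> R by [].
apply: (@le_trans _ _ (gauss N l)); last first.
  by rewrite ler_peMl ?expR_ge0 // ler1n bin_gt0; lia.
apply: (@le_trans _ _ (2 ^+ N)); first by rewrite -natrX ler_nat bin_leq_exp2.
apply: (@le_trans _ _ (expR (3 / 4) ^+ N)).
  by rewrite lerXn2r ?nnegrE ?expR_ge0 ?two_leq_expR.
rewrite -expRM_natl ler_expR ler_pdivlMr //; nra.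
Qed.

End CentralBinomial.

Lemma bin_leq_central M j : ('C(M, j) <= 'C(M, M./2))%N.
Proof.
have [jM|Mj] := leqP j M; last by rewrite bin_small.
have [j2|j2] := leqP j.*2 M; first by apply: bin_unimodal; lia.
by rewrite -(@bin_sub M j) //; apply: bin_unimodal; lia.
Qed.

(** Since [n - 1 <= N + 2], at most two uses of Pascal's rule bound ['C(n.-1, j)] by
    [4 * 'C(N, N./2)]. *)
Lemma interval_sum_leq n N d m : (N.+2 <= n <= N.+3)%N -> (m + d <= n.+1)%N ->
  (\sum_(j < n.+1) up_edges n j * (m <= j < m + d) <=
   n * (4 * 'C(N, N./2)) * d)%N.
Proof.
move=> nN mn; rewrite -[d in leqRHS](sum_interval mn) big_distrr /=.
apply: leq_sum => j _; rewrite leq_mul2r up_edgesE leq_mul2l.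
apply/orP; right; apply/orP; right.
have binS_leq M a c : (forall b, 'C(M, b) <= c)%N -> ('C(M.+1, a) <= 2 * c)%N.
  move=> cM; case: a => [|a]; first by have := cM 0; rewrite !bin0; lia.
  by rewrite binS; have := cM a; have := cM a.+1; lia.
have two := binS_leq N _ _ (bin_leq_central N).
move: (nat_of_ord j) => {}j; have [->|->] : n = N.+2 \/ n = N.+3 by lia.
  by apply: leq_trans (two j) _; lia.
by apply: leq_trans (binS_leq _ _ _ two) _; lia.
Qed.

Section AverageSensitivityGain.
Variables (R : realType) (d l n m : nat).
Let N := (l.*2 + d.+1)%N.
(** [expR (- 5)] absorbs the loss in the exponent; [1/8] combines [1/4] from [interval_sum_leq] with
    [1/2] from [d - 1 >= d / 2]. *)
Let c : R := expR (- 5) / 8.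

Lemma AS_gain (f : cube n -> int) (s : seq int) :
  (1 < d)%N -> (N.+2 <= n <= N.+3)%N ->
  (m.*2 + d <= n <= (m.*2 + d).+1)%N -> (0 < m)%N -> closest_roots n d s ->
  (\sum_(j < n.+1) up_edges n j * (m <= j < m + d) + d.-1 * 'C(N, l) <=
   dichromatic f)%N ->
  AS R f > AS R (@fstar n s) /\
  AS R f >= (1 + c * n%:R^-1 * expR (- (d%:R ^+ 2 / n%:R))) * AS R (@fstar n s).
Proof.
move=> d1 nN mn m0 ss gain.
have star_le := fstar_count mn m0 ss.
have w0 : (0 < 'C(N, l))%N by rewrite bin_gt0 /N; lia.
have p0 : 0 < 2 ^ (1 - n%:Z) :> R by rewrite exprz_gt0.
rewrite /AS; split.
  rewrite ltr_pM2l // ltr_nat (leq_ltn_trans star_le) //.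
  by apply: leq_trans gain; rewrite -addn1 leq_add2l muln_gt0; lia.
rewrite mulrCA ler_pM2l // mulrDl mul1r.
have gainR : (dichromatic (@fstar n s))%:R + (d.-1 * 'C(N, l))%:R <=
    (dichromatic f)%:R :> R.
  by rewrite -natrD ler_nat (leq_trans _ gain) // leq_add2r.
apply: le_trans gainR; rewrite lerD2l.
have n0 : 0 < n%:R :> R by rewrite ltr0n; lia.
have D_le : (dichromatic (@fstar n s))%:R <= n%:R * (4 * 'C(N, N./2)%:R) * d%:R :> R.
  rewrite -!natrM ler_nat (leq_trans star_le) //; apply: interval_sum_leq => //.
  lia.
have N0 : 0 < N%:R :> R by rewrite ltr0n /N; lia.
have NE : N%:R = 2 * l%:R + d%:R + 1 :> R.
  by rewrite /N natrD -muln2 natrM -[d.+1%:R]natr1; lra.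
have l0 : 0 <= l%:R :> R by [].
have d2 : 2 <= d%:R :> R by rewrite ler_nat.
have nNR : n%:R <= N%:R + 3 :> R by rewrite -natrD ler_nat; lia.
(* As [N - 2 l = d + 1 <= N], passing from [(d + 1)^2 / N] to [d^2 / (N + 3)] costs at most 5; the
   main terms are [3 d^2 + 2 d N <= 5 N^2]. *)
have exponent : (N%:R - 2 * l%:R) ^+ 2 / N%:R <= 5 + d%:R ^+ 2 / n%:R :> R.
  apply: (@le_trans _ _ (5 + d%:R ^+ 2 / (N%:R + 3))); last first.
    by rewrite lerD2l ler_wpM2l ?sqr_ge0 // lef_pV2 ?posrE //; lra.
  have -> : 5 + d%:R ^+ 2 / (N%:R + 3) =
      (5 * (N%:R + 3) + d%:R ^+ 2) / (N%:R + 3) :> R by field; lra.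
  rewrite ler_pdivrMr // mulrAC ler_pdivlMr; last by lra.
  have -> : N%:R - 2 * l%:R = d%:R + 1 :> R by lra.
  have : d%:R + 1 <= N%:R :> R by lra.
  by nra.
have C_le : 'C(N, N./2)%:R <= 'C(N, l)%:R * (expR 5 * expR (d%:R ^+ 2 / n%:R)) :> R.
  apply: le_trans (@central_bin_leq R N l _ _) _; try by rewrite /N; lia.
  by rewrite ler_wpM2l // -expRD ler_expR.
set x := d%:R ^+ 2 / n%:R in C_le *.
have cx0 : 0 <= c * n%:R^-1 * expR (- x).
  by rewrite !mulr_ge0 ?expR_ge0 ?invr_ge0 // ltW.
apply: le_trans (ler_wpM2l cx0 D_le) _.
have C_le' : n%:R * (4 * 'C(N, N./2)%:R) * d%:R <=
    n%:R * (4 * ('C(N, l)%:R * (expR 5 * expR x))) * d%:R :> R.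
  by apply: ler_wpM2r => //; rewrite !ler_pM2l.
apply: le_trans (ler_wpM2l cx0 C_le') _.
have -> : c * n%:R^-1 * expR (- x) * (n%:R * (4 * ('C(N, l)%:R * (expR 5 * expR x))) * d%:R) =
    (expR (- 5) * expR 5) * (expR (- x) * expR x) * (n%:R^-1 * n%:R) *
    ('C(N, l)%:R * (d%:R / 2)) by rewrite /c; field; rewrite gt_eqF.
rewrite -!expRD !addNr addr0 expR0 mul1r mulVf ?gt_eqF // mul1r natrM mulrC.
rewrite ler_wpM2r // -subn1 natrB; last by lia.
lra.
Qed.

End AverageSensitivityGain.

Theorem mainTheorem1 (R : realType) :
  exists c : R, 0 < c /\
    forall n d : nat,
      ((5 <= n)%N /\ odd n /\ d = 2%N) \/
      ((7 <= n)%N /\ (3 <= d)%N /\ (d <= n - 3)%N) ->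
      exists f : cube n -> int,
        PTF R d f /\
        forall s : seq int, closest_roots n d s ->
          AS R f > AS R (@fstar n s) /\
          AS R f >=
            (1 + c * n%:R^-1 * expR (- (d%:R ^+ 2 / n%:R))) * AS R (@fstar n s).
Proof.
exists (expR (- 5) / 8); split; first by rewrite divr_gt0 ?expR_gt0.
(* Odd [n + d] takes [k = 2] and covers all of criterion (i), so [d >= 3] in the even case. *)
move=> n d nd; have [nd_odd|nd_even] := boolP (odd (n + d)).
  have [l nE] : exists l, n = (2 + (l.*2 + d.+1))%N.
    exists (n - d - 3)./2; have := odd_double_half (n - d - 3); lia.
  subst n; exists (@blockfun 2 _ (slice2 d l)).
  split=> [|s ss]; first by apply: slice2_PTF; lia.
  apply: (@AS_gain R d l _ l.+1) => //; try lia.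
  rewrite -alt_count; have := @gain2 d l; lia.
have [l nE] : exists l, n = (3 + (l.*2 + d.+1))%N.
  exists (n - d - 4)./2; have := odd_double_half (n - d - 4); lia.
subst n; exists (@blockfun 3 _ (slice3 d l)).
split=> [|s ss]; first by apply: slice3_PTF; lia.
apply: (@AS_gain R d l _ l.+2) => //; try lia.
(* The two corners gain [2 (d - 2)], at least [d - 1] because [d >= 3]. *)
rewrite -alt_count; have := @gain3 d l; nia.
Qed.
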